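(* There is an $O(|V|+|E|)$-time algorithm that, given a connected graph $G=(V,E)$ with edge weights and a set $Y\subset V$, decides whether there exists a perfect edge dominating set of $G$ whose associated 3-colouring is $(\{b\},Y,V\setminus(Y\cup\{b\}))$ for some vertex $b$; moreover, the algorithm finds such a vertex $b$ for which the sum of the weights of the edges incident to $b$ is minimum.
   Context: Graphs are finite, simple and undirected. An edge dominates itself and every edge sharing an endpoint with it. A set $P\subseteq E(G)$ is a perfect edge dominating set if every edge of $E(G)\setminus P$ is dominated by exactly one edge of $P$. The 3-colouring $(B,Y,W)$ associated to $P$ is: $B$ the vertices incident to at least two edges of $P$ (black), $Y$ those incident to exactly one edge of $P$ (yellow), $W$ those incident to no edge of $P$ (white). *)

(* Defs.v *)
From HB Require Import structures.
From mathcomp Require Import all_boot all_order all_algebra.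

Set Implicit Arguments.
Unset Strict Implicit.
Unset Printing Implicit Defensive.

Import Order.TTheory GRing.Theory Num.Theory.

(** * Graphs and perfect edge domination *)

Section PerfectEdgeDomination.

Variables (V : finType) (e : rel V).
Implicit Types (f g : {set V}) (P : {set {set V}}) (v b : V) (Y : {set V}).

Definition simple_graph : Prop := symmetric e /\ irreflexive e.

Definition connected_graph : Prop := 0 < #|V| /\ forall x y : V, connect e x y.

Definition edges : {set {set V}} := [set [set x; y] | x in V, y in V & e x y].

Definition dominates f g : bool := (f == g) || ~~ [disjoint f & g].

Definition perfect_edge_dominating P : Prop :=
  P \subset edges /\
  forall f, f \in edges :\: P -> #|[set g in P | dominates g f]| = 1.

Definition incident P v : {set {set V}} := [set f in P | v \in f].

Definition black P : {set V} := [set v | 2 <= #|incident P v|].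
Definition yellow P : {set V} := [set v | #|incident P v| == 1].
Definition white P : {set V} := [set v | #|incident P v| == 0].

Definition colouring P : {set V} * {set V} * {set V} :=
  (black P, yellow P, white P).

Definition feasible Y b : Prop :=
  exists P, perfect_edge_dominating P /\
            colouring P = ([set b], Y, ~: (Y :|: [set b])).

Definition incident_weight (R : nmodType) (w : {set V} -> R) b : R :=
  (\sum_(f in incident edges b) w f)%R.

Definition optimal (R : realDomainType) (w : {set V} -> R) Y b : Prop :=
  feasible Y b /\
  forall b', feasible Y b' -> (incident_weight w b <= incident_weight w b')%R.

End PerfectEdgeDomination.

(** * Random access machine *)

(** Programs are structured programs over integer registers, integer arrays,
    weight registers and weight arrays, all named by natural numbers.  They do
    not depend on the type of weights: weights can only be moved, added,
    compared and set to zero.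

    On integers, every instruction raises the largest stored value by at most
    one, apart from the constants written in the program.  So in [t] steps all
    integers stay below (largest input integer or constant) + [t], and charging
    one unit per instruction agrees with a machine whose words have a
    logarithmic number of bits. *)

Inductive test : Type :=
| TEq  of nat & nat              (* integer registers x = y *)
| TLt  of nat & nat              (* integer registers x < y *)
| TWLt of nat & nat.             (* weight registers p < q *)

Inductive cmd : Type :=
| Skip
| Const  of nat & nat            (* x := constant c *)
| Copy   of nat & nat            (* x := y *)
| Succ   of nat & nat            (* x := y + 1 *)
| Minus  of nat & nat & nat      (* x := y - z, truncated at 0 *)
| Read   of nat & nat & nat      (* x := a[i], i an integer register *)
| Write  of nat & nat & nat      (* a[i] := x, i an integer register *)
| WZero  of nat                  (* p := 0 *)
| WCopy  of nat & nat            (* p := q *)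
| WAdd   of nat & nat & nat      (* p := q + r *)
| WRead  of nat & nat & nat      (* p := a[i], a a weight array *)
| WWrite of nat & nat & nat      (* a[i] := p, a a weight array *)
| Seq    of cmd & cmd
| If     of test & cmd & cmd
| While  of test & cmd.

Record state (R : Type) : Type := State {
  ireg : nat -> nat;
  iarr : nat -> nat -> nat;
  wreg : nat -> R;
  warr : nat -> nat -> R
}.

Definition upd (A : Type) (f : nat -> A) (i : nat) (x : A) : nat -> A :=
  fun j => if j == i then x else f j.

Section Semantics.

Variable R : realDomainType.
Implicit Types (s : state R) (c : cmd) (b : test).

Definition set_ireg s x k : state R :=
  State (upd (ireg s) x k) (iarr s) (wreg s) (warr s).
Definition set_iarr s a i k : state R :=
  State (ireg s) (upd (iarr s) a (upd (iarr s a) i k))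
        (wreg s) (warr s).
Definition set_wreg s p (z : R) : state R :=
  State (ireg s) (iarr s) (upd (wreg s) p z) (warr s).
Definition set_warr s a i (z : R) : state R :=
  State (ireg s) (iarr s) (wreg s)
        (upd (warr s) a (upd (warr s a) i z)).

Definition eval_test b s : bool :=
  match b with
  | TEq x y => ireg s x == ireg s y
  | TLt x y => ireg s x < ireg s y
  | TWLt p q => (wreg s p < wreg s q)%R
  end.

(** [exec c s t s']: started in [s], [c] halts in [s'] after [t] unit-cost
    steps; each basic instruction and each evaluation of a test is one step. *)
Inductive exec : cmd -> state R -> nat -> state R -> Prop :=
| ESkip s : exec Skip s 1 s
| EConst s x k : exec (Const x k) s 1 (set_ireg s x k)
| ECopy s x y : exec (Copy x y) s 1 (set_ireg s x (ireg s y))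
| ESucc s x y : exec (Succ x y) s 1 (set_ireg s x (ireg s y).+1)
| EMinus s x y z : exec (Minus x y z) s 1 (set_ireg s x (ireg s y - ireg s z))
| ERead s x a i : exec (Read x a i) s 1 (set_ireg s x (iarr s a (ireg s i)))
| EWrite s a i x : exec (Write a i x) s 1 (set_iarr s a (ireg s i) (ireg s x))
| EWZero s p : exec (WZero p) s 1 (set_wreg s p 0%R)
| EWCopy s p q : exec (WCopy p q) s 1 (set_wreg s p (wreg s q))
| EWAdd s p q r : exec (WAdd p q r) s 1 (set_wreg s p (wreg s q + wreg s r)%R)
| EWRead s p a i : exec (WRead p a i) s 1 (set_wreg s p (warr s a (ireg s i)))
| EWWrite s a i p : exec (WWrite a i p) s 1 (set_warr s a (ireg s i) (wreg s p))
| ESeq c1 c2 s t1 s1 t2 s2 :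
    exec c1 s t1 s1 -> exec c2 s1 t2 s2 -> exec (Seq c1 c2) s (t1 + t2) s2
| EIf b c1 c2 s t s' :
    exec (if eval_test b s then c1 else c2) s t s' -> exec (If b c1 c2) s t.+1 s'
| EWhileF b c s : ~~ eval_test b s -> exec (While b c) s 1 s
| EWhileT b c s t1 s1 t2 s2 :
    eval_test b s -> exec c s t1 s1 -> exec (While b c) s1 t2 s2 ->
    exec (While b c) s (t1 + t2).+1 s2.

Lemma exec_det c s t1 s1 t2 s2 :
  exec c s t1 s1 -> exec c s t2 s2 -> t1 = t2 /\ s1 = s2.
Proof.
move=> E; elim: E t2 s2 => {c s t1 s1}.
1-12: by move=> *; match goal with H : exec _ _ _ _ |- _ => inversion H end.
- move=> c1 c2 s t1 s1 t2 s2 _ IH1 _ IH2 t s' E; inversion E; subst.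
  match goal with H : exec c1 _ _ _ |- _ => case: (IH1 _ _ H) => ? ? end; subst.
  by match goal with H : exec c2 _ _ _ |- _ => case: (IH2 _ _ H) => ? ? end; subst.
- move=> b c1 c2 s t s' _ IH t' s'' E; inversion E; subst.
  by match goal with H : exec (if _ then _ else _) _ _ _ |- _ =>
    case: (IH _ _ H) => -> -> end.
- move=> b c s nb t s' E; inversion E; subst=> //.
  by match goal with H : is_true (eval_test b s) |- _ => rewrite H in nb end.
- move=> b c s t1 s1 t2 s2 hb _ IH1 _ IH2 t s' E; inversion E; subst.
    by match goal with H : is_true (~~ _) |- _ => rewrite hb in H end.
  match goal with H : exec c _ _ _ |- _ => case: (IH1 _ _ H) => ? ? end; subst.
  by match goal with H : exec (While b c) _ _ _ |- _ =>
    case: (IH2 _ _ H) => -> -> end.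
Qed.

End Semantics.

(** * Input and output *)

Section InputOutput.

Variables (R : realDomainType) (n : nat).
Implicit Types (e : rel 'I_n) (w : {set 'I_n} -> R) (Y : {set 'I_n}).

Definition adjacency_lists e (adj : 'I_n -> seq 'I_n) : Prop :=
  forall v, uniq (adj v) /\ forall u, (u \in adj v) = e v u.

Definition arcs (adj : 'I_n -> seq 'I_n) : seq ('I_n * 'I_n) :=
  [seq (v, u) | v <- enum 'I_n, u <- adj v].

(** The adjacency lists are stored one after the other: the neighbours of [v]
    are the cells [a0[v]], ..., [a0[v+1] - 1] of integer array 1, with [a0]
    integer array 0, and the weights of the corresponding edges are in the same
    cells of weight array 0.  Integer array 2 is the characteristic vector of
    [Y], integer register 0 contains [n], and everything else is 0. *)
Definition input w Y (adj : 'I_n -> seq 'I_n) : state R :=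
  {| ireg := fun x => if x is 0 then n else 0;
     iarr := fun a => match a with
       | 0 => nth 0 [seq \sum_(v < n | v < k) size (adj v) | k <- iota 0 n.+1]
       | 1 => nth 0 [seq val p.2 | p <- arcs adj]
       | 2 => nth 0 [seq nat_of_bool (v \in Y) | v <- enum 'I_n]
       | _ => fun=> 0
       end;
     wreg := fun=> 0%R;
     warr := fun a => match a with
       | 0 => nth 0%R [seq w [set p.1; p.2] | p <- arcs adj]
       | _ => fun=> 0%R
       end |}.

(** Integer register 0 holds 0 for the answer "no", and [b + 1] for the answer
    "yes" together with vertex [b]. *)
Definition output (s : state R) : option nat :=
  if ireg s 0 is b.+1 then Some b else None.

Definition correct_output e w Y (r : option nat) : Prop :=
  match r with
  | Some k => exists b : 'I_n, k = b /\ optimal e w Y b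
  | None => ~ exists b : 'I_n, feasible e Y b
  end.

End InputOutput.

(* Main.v *)
(** An edge outside a perfect edge dominating set P joins a yellow vertex to a
    white one, so P is the set of all edges inside Y + b.  Hence b is feasible
    iff V \ Y is independent, every vertex of Y has at most one neighbour in Y,
    and the neighbourhood of b, of size at least 2, is exactly the set L of the
    vertices of Y without neighbour in Y ("lonely" vertices).  Given the first
    two conditions, the last one says that all neighbours of b are in L and that
    their number is |L| >= 2.  So one pass over the adjacency lists checks the
    first two conditions and computes L, and a second pass tests every vertex
    outside Y and keeps a candidate of least incident weight. *)

Require Import Defs.
From HB Require Import structures.
From mathcomp Require Import all_boot all_order all_algebra.
From mathcomp Require Import zify.

Set Implicit Arguments.
Unset Strict Implicit.
Unset Printing Implicit Defensive.

(** * Edges, incidence and degrees in a simple graph *)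

Lemma set2_injr (T : finType) (x : T) : injective (fun y : T => [set x; y]).
Proof.
move=> y z eq_yz.
have := set22 x y; rewrite eq_yz !inE => /orP[/eqP yx|/eqP //].
by have := set22 x z; rewrite -eq_yz yx setUid inE => /eqP.
Qed.

Section Graph.

Variables (V : finType) (e : rel V).
Hypothesis graph_e : simple_graph e.
Implicit Types (P : {set {set V}}) (Y A : {set V}) (f : {set V}) (v b : V).

Let sym_e : symmetric e. Proof. by case: graph_e. Qed.
Let irr_e : irreflexive e. Proof. by case: graph_e. Qed.

Lemma edgeP f : reflect (exists x y, e x y /\ f = [set x; y]) (f \in edges e).
Proof.
apply: (iffP imset2P) => [[x y _]|[x [y [exy ->]]]].
  by rewrite inE => /andP[_ exy] ->; exists x, y.
by exists x y; rewrite ?inE.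
Qed.

Lemma mem_edges x y : ([set x; y] \in edges e) = e x y.
Proof.
apply/edgeP/idP => [[a [b [eab eq_xy]]]|exy]; last by exists x, y.
have := set21 x y; rewrite eq_xy => /set2P[] xE; subst x.
  by rewrite (set2_injr eq_xy).
by rewrite [RHS]setUC in eq_xy; rewrite (set2_injr eq_xy) sym_e.
Qed.

(** An edge at [v] is determined by its other end, so counting edges of [P] at [v] amounts to
    counting vertices. *)
Lemma incidentE P v : P \subset edges e ->
  incident P v = [set [set v; u] | u in [set u | [set v; u] \in P]].
Proof.
move=> /subsetP subP; apply/setP => f; rewrite !inE.
apply/andP/imsetP => [[fP]|[u]]; last by rewrite inE => uP ->; rewrite set21.
have /edgeP[x [y [_ fE]]] := subP _ fP.
rewrite fE => /set2P[] vE; subst v; [exists y | exists x] => //; rewrite ?inE.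
- by rewrite -fE.
- by rewrite setUC -fE.
- by rewrite setUC.
Qed.

Lemma card_incident P v : P \subset edges e ->
  #|incident P v| = #|[set u | [set v; u] \in P]|.
Proof. by move=> subP; rewrite incidentE // card_imset //; apply: set2_injr. Qed.

Lemma card_incident_edges v : #|incident (edges e) v| = #|[set u | e v u]|.
Proof.
by rewrite card_incident //; congr #|pred_of_set _|; apply/setP=> u; rewrite !inE mem_edges.
Qed.

Lemma card_edge f : f \in edges e -> #|f| <= 2.
Proof. by case/edgeP=> x [y [_ ->]]; rewrite cards2; case: (_ != _). Qed.

(** Double counting of the pairs vertex-edge, each edge having at most two ends. This bounds the
    total length of the adjacency lists. *)
Lemma sum_degree_le : \sum_v #|[set u | e v u]| <= 2 * #|edges e|.
Proof.
have -> : \sum_v #|[set u | e v u]| = \sum_v \sum_(f in edges e) (v \in f : nat).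
  apply: eq_bigr => v _; rewrite -card_incident_edges -sum1_card big_mkcond.
  rewrite [RHS]big_mkcond; apply: eq_bigr => f _.
  by rewrite inE; case: (f \in edges e); case: (v \in f).
rewrite exchange_big /= mulnC -sum_nat_const; apply: leq_sum => f /card_edge.
by apply: leq_trans; rewrite -sum1_card [leqRHS]big_mkcond;
  apply: leq_sum => v _; case: (v \in f).
Qed.

Lemma incident_weightE (R : nmodType) (w : {set V} -> R) v :
  incident_weight e w v = (\sum_(u | e v u) w [set v; u])%R.
Proof.
rewrite /incident_weight incidentE // big_imset /=; last first.
  by move=> u u' _ _; apply: set2_injr.
by apply: eq_bigl => u; rewrite inE mem_edges.
Qed.

(** * Perfect edge domination through incidence counts *)

(** The dominators of [[set x; y]] are the edges of [P] at [x] or at [y]. An edge at both would be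
    [[set x; y]] itself, which is not in [P], so the two counts add up. *)
Lemma card_dominators P x y : P \subset edges e -> x != y -> [set x; y] \notin P ->
  #|[set g in P | dominates g [set x; y]]| = #|incident P x| + #|incident P y|.
Proof.
move=> subP neq_xy xyNP.
rewrite -cardsUI [X in _ + #|pred_of_set X|](_ : _ = set0); last first.
  apply/setP => g; rewrite inE (incidentE x subP) !inE.
  apply/negP => /andP[/imsetP[u]]; rewrite inE => xuP -> /andP[_].
  by rewrite !inE eq_sym (negPf neq_xy) => /eqP yu; rewrite yu xuP in xyNP.
rewrite cards0 addn0; congr #|pred_of_set _|; apply/setP => g; rewrite !inE /dominates.
case gP: (g \in P) => //=; have /negPf -> : g != [set x; y].
  by apply: contraNneq xyNP => <-.
rewrite /= disjoint_sym disjoints_subset subUset !sub1set !inE.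
by rewrite negb_and !negbK.
Qed.

Lemma perfect_edge_dominatingP P : P \subset edges e ->
  perfect_edge_dominating e P <->
  forall x y, e x y -> [set x; y] \notin P -> #|incident P x| + #|incident P y| = 1.
Proof.
move=> subP; have neq x y : e x y -> x != y by apply: contraTneq => ->; rewrite irr_e.
split=> [[_ domP] x y exy xyNP|domP].
  by rewrite -card_dominators ?neq // domP // inE xyNP mem_edges.
split=> // f /setDP[/edgeP[x [y [exy ->]]] xyNP].
by rewrite card_dominators ?domP ?neq.
Qed.

(* The set P is forced: an edge outside P joins a yellow vertex to a white one,
   so P consists of all edges inside [b |: Y]. *)
Lemma feasibleP Y b : feasible e Y b <->
  [/\ b \notin Y, 1 < #|[set u | e b u]|,
      {in Y, forall y, #|[set u in b |: Y | e y u]| = 1}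
    & forall x y, x \notin Y -> e x y -> y \in Y].
Proof.
split=> [[P [perfP]]|[bNY deg_b deg_Y indep]].
  have [subP _] := perfP; move/perfect_edge_dominatingP: (subP) perfP => -> domP.
  rewrite /colouring /white => -[/setP black_b /setP yellow_Y /setP white_W].
  have degb : 1 < #|incident P b| by have := black_b b; rewrite !inE eqxx.
  have degY y : (y \in Y) = (#|incident P y| == 1) by rewrite -yellow_Y inE.
  have deg0 y : y \notin b |: Y -> #|incident P y| = 0.
    by have := white_W y; rewrite !inE orbC => + yW; rewrite yW => /eqP.
  have bNY : b \notin Y by rewrite degY; case: #|_| degb => [|[]].
  (* Edges of [P] avoid white vertices. *)
  have memP x y : [set x; y] \in P -> y \in b |: Y.
    move=> xyP; apply: contraLR isT => /deg0/eqP; rewrite cards_eq0 => /eqP/setP/(_ [set x; y]).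
    by rewrite !inE xyP eqxx orbT.
  (* Each end has count at least 1, whereas the ends of an edge outside [P] have total count 1. *)
  have nbrP x y : x \in b |: Y -> y \in b |: Y -> e x y -> [set x; y] \in P.
    have pos z : z \in b |: Y -> 0 < #|incident P z|.
      by rewrite !inE degY => /orP[/eqP ->|/eqP -> //]; apply: ltnW.
    move=> /pos px /pos py exy; apply: contraT => /(domP _ _ exy) E.
    by move: px py E; case: #|_| => // k; case: #|_| => // l; rewrite addSn addnS.
  (* The count of [b] alone exceeds 1, so no edge at [b] can be outside [P]. *)
  have nbr_b y : e b y -> [set b; y] \in P.
    move=> eby; apply: contraT => /(domP _ _ eby) E.
    by move: degb; rewrite ltnNge -E leq_addr.
  have degE x : x \in b |: Y -> #|incident P x| = #|[set u in b |: Y | e x u]|.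
    move=> xS; rewrite card_incident //; congr #|pred_of_set _|; apply/setP => u.
    rewrite in_set in_set.
    apply/idP/andP => [xuP|[uS exu]]; last exact: nbrP.
    by rewrite (memP _ _ xuP) -mem_edges (subsetP subP).
  split=> //.
  - apply: leq_trans degb _; rewrite degE ?setU11 //; apply/subset_leq_card/subsetP => u.
    by rewrite !inE => /andP[].
  - by move=> y yY; rewrite -degE; [apply/eqP; rewrite -degY|rewrite inE yY orbT].
  - move=> x y xNY exy; have [xb|xNb] := eqVneq x b.
      move: exy; rewrite xb => eby; have := memP _ _ (nbr_b _ eby); rewrite !inE => /orP[|//].
      by move=> /eqP yb; rewrite yb irr_e in eby.
    (* Here [x] is white: the edge is outside [P] and [x] contributes 0 to the total 1, so [y] is
       yellow. *)
    have xW : x \notin b |: Y by rewrite !inE negb_or xNb.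
    rewrite degY -(domP x y) ?(deg0 _ xW) //; apply: contra xW => xyP.
    by apply: (memP y); rewrite setUC.
pose P := [set f in edges e | f \subset b |: Y].
have subP : P \subset edges e by apply/subsetP => f; rewrite inE => /andP[].
have memP x y : ([set x; y] \in P) = [&& e x y, x \in b |: Y & y \in b |: Y].
  by rewrite inE mem_edges subUset !sub1set.
have degE x : x \in b |: Y -> #|incident P x| = #|[set u in b |: Y | e x u]|.
  move=> xS; rewrite card_incident //; congr #|pred_of_set _|; apply/setP => u.
  by rewrite in_set memP xS in_set andbC.
have degW x : x \notin b |: Y -> #|incident P x| = 0.
  move=> xW; rewrite card_incident //; apply/eqP; rewrite cards_eq0; apply/eqP/setP => u.
  by rewrite in_set memP (negPf xW) andbF in_set0.
have degY y : y \in Y -> #|incident P y| = 1.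
  by move=> yY; rewrite degE ?deg_Y // inE yY orbT.
have degb : 1 < #|incident P b|.
  rewrite degE ?setU11 //; apply: leq_trans deg_b _; apply/subset_leq_card/subsetP => u.
  by rewrite !inE => ebu; rewrite ebu (indep b) ?orbT.
exists P; split.
  apply/perfect_edge_dominatingP => // x y exy; rewrite memP exy /= negb_and.
  (* An edge outside [P] has an end outside [b |: Y], with count 0. By symmetry this is [x], and
     then independence puts [y] in [Y], with count 1. *)
  wlog xW : x y exy / x \notin b |: Y => [IH|_].
    case/orP=> [xW|yW]; [apply: IH|rewrite addnC; apply: IH] => //; rewrite ?xW ?yW //.
    by rewrite sym_e.
  by rewrite degW // degY //; apply: (indep x) => //; apply: contra xW; rewrite inE orbC => ->.
have degP v : #|incident P v| = if v == b then #|incident P b| else (v \in Y : nat).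
  case: eqVneq => [-> //|vNb]; case: (boolP (v \in Y)) => [/degY //|vNY].
  by rewrite degW // !inE negb_or vNb.
rewrite /colouring; congr (_, _, _); apply/setP => v; rewrite !inE degP.
- by case: (eqVneq v b) => [_|_]; rewrite ?degb //; case: (v \in Y).
- case: (eqVneq v b) => [->|_]; last by case: (v \in Y).
  by rewrite (negPf bNY) gtn_eqF.
- case: (eqVneq v b) => [->|_]; last by case: (v \in Y).
  by rewrite gtn_eqF ?orbT // ltnW.
Qed.

(** * Feasibility as conditions on single vertices *)

Definition degree_in A v := #|[set u in A | e v u]|.

Definition lonely Y := [set y in Y | degree_in Y y == 0].

Definition admissible Y v :=
  if v \in Y then degree_in Y v <= 1 else degree_in (~: Y) v == 0.

(** That the neighbourhood of [v] is [lonely Y] is expressed by counts alone, so that one scan of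
    the list of [v] decides it. *)
Definition candidate Y v :=
  [&& v \notin Y, degree_in (~: lonely Y) v == 0,
      degree_in (lonely Y) v == #|lonely Y| & 1 < degree_in (lonely Y) v].

Lemma degree_in_eq0 A v : reflect (forall u, e v u -> u \notin A) (degree_in A v == 0).
Proof.
rewrite /degree_in cards_eq0; apply: (iffP eqP) => [/setP A0 u evu|A0].
  by have := A0 u; rewrite !inE evu andbT => ->.
by apply/setP => u; rewrite !inE; apply/andP => -[uA /A0]; rewrite uA.
Qed.

Lemma degree_inU1 Y b v : b \notin Y -> degree_in (b |: Y) v = e v b + degree_in Y v.
Proof.
move=> bNY; rewrite /degree_in (cardsD1 b) !inE eqxx; congr (_ + #|pred_of_set _|).
by apply/setP => u; rewrite !inE; case: eqVneq => [->|]; rewrite // (negPf bNY).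
Qed.

Lemma feasible_candidate Y b :
  feasible e Y b <-> (forall v, admissible Y v) /\ candidate Y b.
Proof.
split=> [/feasibleP[bNY deg_b deg_Y indep]|[adm /and4P[bNY nbr_lonely card_lonely gt1]]].
  have degY y : y \in Y -> e y b + degree_in Y y = 1.
    by move=> yY; rewrite -degree_inU1 //; apply: deg_Y.
  (* In [degY] exactly one summand is 1: a vertex of [Y] is adjacent to [b] iff it has no neighbour
     in [Y]. *)
  have lonelyE : lonely Y = [set u | e b u].
    apply/setP => y; rewrite !inE sym_e; case: (boolP (y \in Y)) => [/degY|yNY] /=.
      by case: (e y b) => /=; case: (degree_in Y y) => [|[]].
    by apply/esym; apply: contraNF yNY; rewrite sym_e; apply: indep.
  have degE : degree_in (lonely Y) b = #|lonely Y|.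
    by apply: eq_card => u; rewrite lonelyE !inE andbb.
  split=> [v|].
    rewrite /admissible; case: ifPn => [/degY <-|vNY]; first exact: leq_addl.
    by apply/degree_in_eq0 => u evu; rewrite inE negbK (indep v).
  rewrite /candidate bNY degE eqxx lonelyE deg_b !andbT /=.
  by apply/degree_in_eq0 => u ebu; rewrite !inE ebu.
have {nbr_lonely} sub_lonely : [set u | e b u] \subset lonely Y.
  apply/subsetP => u; rewrite inE => ebu.
  by move/degree_in_eq0/(_ u ebu): nbr_lonely; rewrite in_setC negbK.
(* Inclusion together with equal cardinality. *)
have lonelyE : [set u | e b u] = lonely Y.
  apply/eqP; rewrite eqEcard sub_lonely -(eqP card_lonely).
  by apply/subset_leq_card/subsetP => u; rewrite !inE => /andP[].
apply/feasibleP; split=> //.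
- by rewrite lonelyE -(eqP card_lonely).
- move=> y yY; rewrite -/(degree_in _ _) degree_inU1 //.
  have := adm y; rewrite /admissible yY sym_e.
  have /setP/(_ y) := lonelyE; rewrite !inE yY /= => ->.
  by case: (degree_in Y y) => [|[]].
- move=> x y xNY exy; have := adm x; rewrite /admissible (negPf xNY) => /degree_in_eq0/(_ y exy).
  by rewrite inE negbK.
Qed.

End Graph.

(** * Weakest preconditions with step counting *)

Section Wp.

Variable R : realDomainType.
Implicit Types (s : state R) (c : cmd) (b : test) (t : nat) (Q : nat -> state R -> Prop).

(* [t] is the number of steps made before [c] is started, so that time bounds
   can be part of the assertions. *)
Definition wp c Q t s := exists t' s', exec c s t' s' /\ Q (t + t') s'.

Lemma wp_weaken c Q Q' t s : (forall t s, Q t s -> Q' t s) -> wp c Q t s -> wp c Q' t s.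
Proof. by move=> QQ' [t' [s' [E /QQ' q]]]; exists t', s'. Qed.

Lemma wp_basic c Q t s s' : exec c s 1 s' -> Q t.+1 s' -> wp c Q t s.
Proof. by move=> E q; exists 1, s'; rewrite addn1. Qed.

Lemma wp_seq c1 c2 Q t s : wp c1 (wp c2 Q) t s -> wp (Seq c1 c2) Q t s.
Proof.
move=> [t1 [s1 [E1 [t2 [s2 [E2 q]]]]]]; exists (t1 + t2), s2.
by rewrite addnA; split=> //; apply: ESeq E1 E2.
Qed.

Lemma wp_if b c1 c2 Q t s :
  wp (if eval_test b s then c1 else c2) Q t.+1 s -> wp (If b c1 c2) Q t s.
Proof. by move=> [t' [s' [E q]]]; exists t'.+1, s'; rewrite -addSnnS; split=> //; apply: EIf. Qed.

(** The number [m] of iterations is fixed in advance, so the index of the invariant also serves as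
    the termination measure. *)
Lemma wp_while b c (I : nat -> nat -> state R -> Prop) m Q t s :
  I 0 t s ->
  (forall k t s, k < m -> I k t s -> eval_test b s /\ wp c (I k.+1) t.+1 s) ->
  (forall t s, I m t s -> ~~ eval_test b s /\ Q t.+1 s) ->
  wp (While b c) Q t s.
Proof.
move=> I0 step stop.
suff loop j k : k + j = m -> forall t s, I k t s -> wp (While b c) Q t s by apply: (loop m 0).
elim: j k {t s I0} => [|j IH] k; first rewrite addn0 => -> t s Ik.
  by have [nb q] := stop _ _ Ik; exists 1, s; rewrite addn1; split=> //; apply: EWhileF.
rewrite addnS -addSn => km t s Ik.
have [|tb [t1 [s1 [E1 I1]]]] := step k t s _ Ik; first by rewrite -km ltnS leq_addr.
have [t2 [s2 [E2 q]]] := IH _ km _ _ I1.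
exists (t1 + t2).+1, s2; rewrite -addSnnS addnA; split=> //.
exact: EWhileT E1 E2.
Qed.

End Wp.

(** * The program *)

Local Notation "c1 ;; c2" := (Seq c1 c2) (at level 61, right associativity).

Local Notation r_n := 0 (only parsing).
Local Notation r_v := 1 (only parsing).
Local Notation r_pos := 2 (only parsing).
Local Notation r_end := 3 (only parsing).
Local Notation r_in := 4 (only parsing).
Local Notation r_out := 5 (only parsing).
Local Notation r_u := 6 (only parsing).
Local Notation r_flag := 7 (only parsing).
Local Notation r_zero := 8 (only parsing).
Local Notation r_one := 9 (only parsing).
Local Notation r_lonely := 10 (only parsing).
Local Notation r_bad := 11 (only parsing).
Local Notation r_next := 12 (only parsing).
(* 0 as long as no candidate [b] is known, then [b + 1] *)
Local Notation r_best := 13 (only parsing).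
Local Notation w_sum := 0 (only parsing).
Local Notation w_arc := 1 (only parsing).
Local Notation w_best := 2 (only parsing).
Local Notation a_off := 0 (only parsing).
Local Notation a_adj := 1 (only parsing).
Local Notation a_Y := 2 (only parsing).
Local Notation a_lonely := 3 (only parsing).

(* Splits the neighbours of the current vertex according to the flags in array
   [a], counting both parts, and sums the weights of its edges. *)
Definition scan a :=
  While (TLt r_pos r_end)
    (Read r_u a_adj r_pos ;; Read r_flag a r_u ;;
     If (TEq r_flag r_one) (Succ r_in r_in) (Succ r_out r_out) ;;
     WRead w_arc 0 r_pos ;; WAdd w_sum w_sum w_arc ;;
     Succ r_pos r_pos).

(** [r_pos] is reset only once: the lists are contiguous, so each scan starts where the previous one
    stopped. *)
Definition sweep a post :=
  Const r_v 0 ;; Const r_pos 0 ;;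
  While (TLt r_v r_n)
    (Const r_in 0 ;; Const r_out 0 ;; WZero w_sum ;;
     Succ r_next r_v ;; Read r_end a_off r_next ;;
     scan a ;; post ;; Copy r_v r_next).

(** [r_bad] is never reset, so it accumulates the violations found at all vertices. *)
Definition classify :=
  Read r_flag a_Y r_v ;;
  If (TEq r_flag r_one)
    (If (TEq r_in r_zero)
       (Write a_lonely r_v r_one ;; Succ r_lonely r_lonely)
       (If (TLt r_one r_in) (Const r_bad 1) Skip))
    (If (TEq r_out r_zero) Skip (Const r_bad 1)).

Definition take_best := Copy r_best r_next ;; WCopy w_best w_sum.

(** Here [r_in] counts lonely neighbours and [r_out] the others. The test on [r_best] comes before
    the comparison of weights because the initial 0 in [w_best] is not the weight of a candidate. *)
Definition update_best :=
  Read r_flag a_Y r_v ;;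
  If (TEq r_flag r_zero)
    (If (TEq r_out r_zero)
       (If (TEq r_in r_lonely)
          (If (TLt r_one r_in)
             (If (TEq r_best r_zero) take_best
                (If (TWLt w_sum w_best) take_best Skip))
             Skip) Skip) Skip) Skip.

(** [r_zero] and the accumulators [r_lonely], [r_bad], [r_best] rely on the zeros of the input
    state. The answer replaces [n] in register 0. *)
Definition find_black :=
  Const r_one 1 ;; sweep a_Y classify ;; sweep a_lonely update_best ;;
  If (TEq r_bad r_zero) (Copy r_n r_best) (Const r_n 0).

(** * Layout of the adjacency lists in memory *)

Lemma sum_ord_ltS n (F : 'I_n -> nat) (v : 'I_n) :
  \sum_(u < n | u < v.+1) F u = \sum_(u < n | u < v) F u + F v.
Proof.
rewrite (bigD1 v) //= addnC; congr (_ + _); apply: eq_bigl => u.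
by rewrite ltnS ltn_neqAle andbC.
Qed.

Lemma sum_take_enum_ord n (F : 'I_n -> nat) k : k <= n ->
  \sum_(u <- take k (enum 'I_n)) F u = \sum_(u < n | u < k) F u.
Proof.
elim: k => [|k IH] lt_kn; first by rewrite take0 big_nil big_pred0.
pose v := Ordinal lt_kn; rewrite (take_nth v) ?size_enum_ord // -cats1 big_cat big_seq1.
by rewrite IH ?(ltnW lt_kn) // -[k]/(val v) nth_ord_enum sum_ord_ltS.
Qed.

Section Correctness.

Variables (R : realDomainType) (n : nat) (e : rel 'I_n) (w : {set 'I_n} -> R).
Variables (Y : {set 'I_n}) (adj : 'I_n -> seq 'I_n).
Hypotheses (graph_e : simple_graph e) (adjE : adjacency_lists e adj).
Implicit Types (s : state R) (t : nat) (v u : 'I_n) (A : {set 'I_n}).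

(** The argument is a natural number so that [offset n], the end of the last list, makes sense. *)
Definition offset k := \sum_(v < n | v < k) size (adj v).

Lemma offsetS v : offset v.+1 = offset v + size (adj v).
Proof. exact: sum_ord_ltS. Qed.

(** Cutting the enumeration of the vertices at [v] isolates the block of [v], which gives random
    access to its cells. *)
Lemma arcs_split v : exists p q,
  arcs adj = p ++ [seq (v, u) | u <- adj v] ++ q /\ size p = offset v.
Proof.
exists [seq (x, u) | x <- take v (enum 'I_n), u <- adj x].
exists [seq (x, u) | x <- drop v.+1 (enum 'I_n), u <- adj x]; split.
  rewrite /arcs -{1}(cat_take_drop v (enum 'I_n)) (drop_nth v) ?size_enum_ord //.
  by rewrite map_cat flatten_cat nth_ord_enum.
by rewrite size_allpairs_dep sumnE big_map sum_take_enum_ord // ltnW.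
Qed.

Lemma nth_map_arcs T (d : T) (f : 'I_n * 'I_n -> T) v k : k < size (adj v) ->
  nth d [seq f p | p <- arcs adj] (offset v + k) = f (v, nth v (adj v) k).
Proof.
move=> lt_k; have [p [q [-> size_p]]] := arcs_split v.
rewrite !map_cat nth_cat size_map size_p ltnNge leq_addr addKn nth_cat !size_map lt_k.
by rewrite -map_comp (nth_map v).
Qed.

Lemma count_adj A v : count [in A] (adj v) = degree_in e A v.
Proof.
have [uniq_v mem_v] := adjE v; rewrite -size_filter /degree_in cardE.
apply/perm_size/uniq_perm => [||u]; [exact: filter_uniq | exact: enum_uniq |].
by rewrite mem_filter mem_enum inE mem_v.
Qed.

Lemma size_adj v : size (adj v) = #|[set u | e v u]|.
Proof.
have [uniq_v mem_v] := adjE v; rewrite cardE; apply/perm_size/uniq_perm => // [|u].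
  exact: enum_uniq.
by rewrite mem_enum inE mem_v.
Qed.

Lemma sum_adj v : (\sum_(u <- adj v) w [set v; u])%R = incident_weight e w v.
Proof.
have [uniq_v mem_v] := adjE v; rewrite incident_weightE // big_uniq //.
by apply: eq_bigl => u; rewrite mem_v.
Qed.

Lemma offset_total : offset n <= 2 * #|edges e|.
Proof.
apply: leq_trans (sum_degree_le graph_e); rewrite /offset big_mkcond.
by apply: leq_sum => v _; rewrite ltn_ord size_adj.
Qed.

(* The parts of the state that no sweep modifies. *)
Definition frame s :=
  [/\ ireg s r_n = n, ireg s r_zero = 0 & ireg s r_one = 1] /\
  [/\ iarr s a_off = iarr (input w Y adj) a_off,
      iarr s a_adj = iarr (input w Y adj) a_adj,
      iarr s a_Y = iarr (input w Y adj) a_Y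
    & warr s 0 = warr (input w Y adj) 0].

(* The parts of the state that only the [post] command of a sweep modifies. *)
Definition kept (J : nat -> nat -> nat -> (nat -> nat) -> R -> Prop) s :=
  J (ireg s r_lonely) (ireg s r_bad) (ireg s r_best) (iarr s a_lonely) (wreg s w_best).

Lemma frame_offset s k : frame s -> k <= n -> iarr s a_off k = offset k.
Proof.
move=> [_ [-> _ _ _]] le_kn.
by rewrite [LHS](nth_map 0) ?size_iota // nth_iota.
Qed.

Lemma frame_adj s v k : frame s -> k < size (adj v) ->
  iarr s a_adj (offset v + k) = nth v (adj v) k.
Proof. by move=> [_ [_ -> _ _]] lt_k; exact: (nth_map_arcs _ (fun p => val p.2)). Qed.

Lemma frame_weight s v k : frame s -> k < size (adj v) ->
  warr s 0 (offset v + k) = w [set v; nth v (adj v) k].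
Proof. by move=> [_ [_ _ _ ->]] lt_k; exact: (nth_map_arcs _ (fun p => w [set p.1; p.2])). Qed.

Lemma frame_Y s v : frame s -> iarr s a_Y v = (v \in Y).
Proof.
move=> [_ [_ _ -> _]].
by rewrite [LHS](nth_map v) ?size_enum_ord // nth_ord_enum.
Qed.

Local Ltac wp_step :=
  first [ apply: wp_seq | apply: wp_if
        | (eapply wp_basic; [by constructor|]) ]; rewrite /= /upd /=.

(** * Effect and running time of a sweep *)

Definition scanned A v s :=
  [/\ ireg s r_in = degree_in e A v, ireg s r_out = degree_in e (~: A) v
    & wreg s w_sum = incident_weight e w v].

(** The situation once the list of [v] is read and [r_v] has not yet advanced: [r_pos] is already at
    the start of the next list. *)
Definition at_vertex v s :=
  [/\ ireg s r_v = v, ireg s r_next = v.+1 & ireg s r_pos = offset v.+1].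

Lemma wp_scan a A v J Q t s :
  frame s -> kept J s -> (forall u, iarr s a u = (u \in A)) ->
  [/\ ireg s r_v = v, ireg s r_next = v.+1, ireg s r_pos = offset v
    & ireg s r_end = offset v.+1] ->
  [/\ ireg s r_in = 0, ireg s r_out = 0 & wreg s w_sum = 0%R] ->
  (forall t' s', t' <= t + 8 * size (adj v) + 1 ->
     frame s' -> kept J s' -> at_vertex v s' -> scanned A v s' -> Q t' s') ->
  wp (scan a) Q t s.
Proof.
move=> fr keep flag [sv snext spos send] [sin sout sw] HQ.
(* After [k] rounds the registers describe the first [k] neighbours. A round takes 8 steps: the loop
   test, the test of the flag and six basic instructions. *)
pose I k t' s' := t' <= t + 8 * k /\
  [/\ frame s', kept J s' & forall u, iarr s' a u = (u \in A)] /\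
  [/\ ireg s' r_v = v, ireg s' r_next = v.+1, ireg s' r_pos = offset v + k
    & ireg s' r_end = offset v.+1] /\
  [/\ ireg s' r_in = count [in A] (take k (adj v)),
      ireg s' r_out = count [in ~: A] (take k (adj v))
    & wreg s' w_sum = (\sum_(u <- take k (adj v)) w [set v; u])%R].
apply: (wp_while (I := I) (m := size (adj v))).
- by rewrite /I take0 big_nil /= muln0 !addn0.
- move=> k {}t' {}s' lt_k [le_t [[fr' keep' flag'] [[v' next' pos' end'] [in' out' w']]]].
  split; first by rewrite /= pos' end' offsetS ltn_add2l.
  do 6 wp_step; rewrite pos' (frame_adj fr' lt_k) flag'.
  have one' : ireg s' r_one = 1 by case: fr' => [[]].
  rewrite one' (_ : (_ == 1) = (nth v (adj v) k \in A)); last by case: (_ \in A).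
  have takeS := take_nth v lt_k.
  case inA: (_ \in A); do 6 wp_step.
  1,2: rewrite /I /= /upd /= takeS -cats1 !count_cat big_cat big_seq1 /= !inE inA.
  1,2: rewrite pos' in' out' w' (frame_weight fr' lt_k) v' next' end' addnS ?addn0 ?addn1.
  1,2: by split; [lia|split; [case: fr'|]].
- move=> {}t' {}s' [le_t [[fr' keep' _] [[v' next' pos' end'] [in' out' w']]]].
  split; first by rewrite /= pos' end' offsetS ltnn.
  apply: HQ => //; first lia; first by split; rewrite ?pos' ?offsetS.
  by rewrite take_size !count_adj sum_adj in in' out' w'.
Qed.

(** [J k] describes the data kept between vertices once all vertices below [k] are treated. The
    bound 9 for [post] is the longest path through [update_best]. *)
Lemma wp_sweep a A post (J : nat -> nat -> nat -> nat -> (nat -> nat) -> R -> Prop) Q t s :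
  (forall v s, frame s -> kept (J v) s -> forall u, iarr s a u = (u \in A)) ->
  (forall v t s, frame s -> kept (J v) s -> at_vertex v s -> scanned A v s ->
     wp post (fun t' s' =>
       [/\ t' <= t + 9, frame s', kept (J v.+1) s' & at_vertex v s']) t s) ->
  frame s -> kept (J 0) s ->
  (forall t' s', t' <= t + 3 + 8 * offset n + 17 * n ->
     frame s' -> kept (J n) s' -> Q t' s') ->
  wp (sweep a post) Q t s.
Proof.
move=> flag Hpost fr keep HQ; do 4 wp_step.
(* Besides 8 steps per arc, a vertex costs 17: the loop test, five initialisations, the last test of
   the scan, at most 9 for [post], and one copy. *)
pose I k t' s' := [/\ t' <= t + 2 + 8 * offset k + 17 * k, frame s', kept (J k) s',
  ireg s' r_v = k & ireg s' r_pos = offset k].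
have offset0 : offset 0 = 0 by rewrite /offset big_pred0.
apply: (wp_while (I := I) (m := n)).
- by split=> //=; rewrite ?offset0 //; lia.
- move=> k {}t' {}s' lt_k [le_t fr' keep' v' pos'].
  split; first by case: fr' => [[/= -> _ _] _]; rewrite v'.
  pose v := Ordinal lt_k; do 11 wp_step.
  apply: (wp_scan (A := A) (v := v) (J := J k)) => //=.
  + exact: (flag v).
  + by rewrite /upd /= v' (frame_offset fr').
  + move=> t1 s1 le_t1 fr1 keep1 at1 sc1; apply: wp_seq.
    apply: wp_weaken (Hpost v _ _ fr1 keep1 at1 sc1) => t2 s2 [le_t2 fr2 keep2 [v2 next2 pos2]].
    wp_step; split; rewrite //= /upd /= ?next2 //.
    by have := offsetS v; rewrite /=; lia.
- move=> {}t' {}s' [le_t fr' keep' v' pos'].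
  split; first by case: fr' => [[/= -> _ _] _]; rewrite v' ltnn.
  by apply: HQ => //; lia.
Qed.

(** * First sweep: admissibility and lonely vertices *)

Definition classified k cnt bad best (flags : nat -> nat) (wbest : R) :=
  [/\ cnt = \sum_(u < n | u < k) (u \in lonely e Y : nat),
      bad = 0 <-> forall u, u < k -> admissible e Y u,
      best = 0
    & forall u, flags u = (u < k) && (u \in lonely e Y) :> nat].

(** Common to all branches of [classify]: each branch has only to supply its values of [bad'] and
    [flags']. *)
Lemma classifiedS v cnt bad bad' best flags flags' wbest :
  classified v cnt bad best flags wbest ->
  (bad' = 0 <-> bad = 0 /\ admissible e Y v) ->
  flags' =1 (if v \in lonely e Y then upd flags v 1 else flags) ->
  classified v.+1 (cnt + (v \in lonely e Y)) bad' best flags' wbest.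
Proof.
move=> [-> badE -> flagsE] bad'E flags'E; split=> // [||u].
- by rewrite sum_ord_ltS.
- rewrite bad'E badE; split=> [[adm adm_v] u|adm].
    by rewrite ltnS leq_eqVlt => /orP[/eqP/val_inj -> //|/adm].
  by split=> [u lt_uv|]; apply: adm; rewrite // ltnS ltnW.
- rewrite flags'E ltnS leq_eqVlt; case: ifP => lon.
    by rewrite /upd flagsE; case: eqP => [/val_inj ->|]; rewrite ?lon.
  by rewrite flagsE; case: eqP => [/val_inj ->|]; rewrite ?lon ?andbF.
Qed.

Lemma wp_classify v t s :
  frame s -> kept (classified v) s -> at_vertex v s -> scanned Y v s ->
  wp classify (fun t' s' =>
    [/\ t' <= t + 9, frame s', kept (classified v.+1) s' & at_vertex v s']) t s.
Proof.
move=> fr keep [v' next' pos'] [in' out' _].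
have [[_ zero' one'] _] := fr.
do 3 wp_step; rewrite v' (frame_Y _ fr) one' /=.
(* Both properties of [v] are read off the counters, so the tests of the program decide them. *)
have adm : admissible e Y v =
  (if v \in Y then ireg s r_in <= 1 else ireg s r_out == 0) by rewrite in' out'.
have lon : (v \in lonely e Y) = (v \in Y) && (ireg s r_in == 0) by rewrite in' inE.
case: (boolP (v \in Y)) adm lon => vY /= adm lon; wp_step; rewrite zero'.
  case: eqP lon => [in0|_] lon.
    do 3 wp_step; split=> //; first lia; rewrite /kept /= /upd /= v' one'.
    have := classifiedS (bad' := ireg s r_bad) (flags' := upd (iarr s a_lonely) v 1) keep.
    by rewrite lon adm in0 addn1; apply=> //; split=> [|[]].
  wp_step; rewrite one'; case: ltnP adm => _ adm; wp_step; split=> //; try lia.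
    have := classifiedS (bad' := 1) (flags' := iarr s a_lonely) keep.
    by rewrite lon adm addn0; apply=> //; split=> [|[]].
  have := classifiedS (bad' := ireg s r_bad) (flags' := iarr s a_lonely) keep.
  by rewrite lon adm addn0; apply=> //; split=> [|[]].
case: eqP adm => _ adm; wp_step; split=> //; try lia.
  have := classifiedS (bad' := ireg s r_bad) (flags' := iarr s a_lonely) keep.
  by rewrite lon adm addn0; apply=> //; split=> [|[]].
have := classifiedS (bad' := 1) (flags' := iarr s a_lonely) keep.
by rewrite lon adm addn0; apply=> //; split=> [|[]].
Qed.

(** * Second sweep: a candidate of least weight *)

(** Admissibility is left out here; it is a condition on all vertices and is settled by the final
    test of [r_bad]. *)
Definition is_best k best (wbest : R) :=
  if best is c.+1 then
    exists b : 'I_n, [/\ c = b, candidate e Y b, wbest = incident_weight e w b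
      & forall u, u < k -> candidate e Y u -> (wbest <= incident_weight e w u)%R]
  else forall u, u < k -> ~~ candidate e Y u.

Definition searched k cnt bad best (flags : nat -> nat) (wbest : R) :=
  [/\ cnt = #|lonely e Y|, bad = 0 <-> forall u, admissible e Y u,
      forall u, flags u = (u \in lonely e Y) & is_best k best wbest].

Lemma is_best_skip v best wbest : is_best v best wbest ->
  (candidate e Y v -> 0 < best /\ (wbest <= incident_weight e w v)%R) ->
  is_best v.+1 best wbest.
Proof.
case: best => [best0 cand_v u|c [b [-> cand_b wE bestE]] cand_v] /=.
  rewrite ltnS leq_eqVlt => /orP[/eqP/val_inj ->|/best0 //].
  by apply/negP => /cand_v[].
exists b; split=> // u; rewrite ltnS leq_eqVlt => /orP[/eqP/val_inj -> /cand_v[]//|].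
exact: bestE.
Qed.

(** The comparison is required only for [0 < best], since before the first candidate [wbest] carries
    no information. Otherwise transitivity applies. *)
Lemma is_best_take v best wbest : is_best v best wbest -> candidate e Y v ->
  (0 < best -> (incident_weight e w v <= wbest)%R) ->
  is_best v.+1 v.+1 (incident_weight e w v).
Proof.
move=> bestE cand_v le_w; exists v; split=> // u.
rewrite ltnS leq_eqVlt => /orP[/eqP/val_inj -> //|lt_uv] cand_u.
case: best bestE le_w => [/(_ u lt_uv)|c [b [_ _ _ bestE]] le_w]; first by rewrite cand_u.
exact: Order.POrderTheory.le_trans (le_w isT) (bestE u lt_uv cand_u).
Qed.

Lemma wp_update_best v t s :
  frame s -> kept (searched v) s -> at_vertex v s -> scanned (lonely e Y) v s ->
  wp update_best (fun t' s' =>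
    [/\ t' <= t + 9, frame s', kept (searched v.+1) s' & at_vertex v s']) t s.
Proof.
move=> fr [cntE badE flagsE bestE] [v' next' pos'] [in' out' w'].
have [[_ zero' one'] _] := fr.
have cand : candidate e Y v = [&& v \notin Y, ireg s r_out == 0,
  ireg s r_in == ireg s r_lonely & 1 < ireg s r_in] by rewrite in' out' cntE.
do 3 wp_step; rewrite v' (frame_Y _ fr) zero' eqb0.
have skip : ~~ candidate e Y v -> is_best v.+1 (ireg s r_best) (wreg s w_best).
  by move=> /negPf ncand; apply: is_best_skip => //; rewrite ncand.
case: (v \notin Y) cand => cand /=; last first.
  by wp_step; split=> //; [lia | split=> //; apply: skip; rewrite cand].
wp_step; rewrite zero'; case: (_ == 0) cand => cand /=; last first.
  by wp_step; split=> //; [lia | split=> //; apply: skip; rewrite cand].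
wp_step; case: (_ == _) cand => cand /=; last first.
  by wp_step; split=> //; [lia | split=> //; apply: skip; rewrite cand].
wp_step; rewrite one'; case: (1 < _) cand => cand /=; last first.
  by wp_step; split=> //; [lia | split=> //; apply: skip; rewrite cand].
wp_step; rewrite zero'; case: eqP => best0.
  do 3 wp_step; split=> //; first lia.
  by split=> //; rewrite /= /upd /= next' w'; apply: is_best_take bestE _ _ => //; rewrite best0.
wp_step; rewrite w'; case: Order.TotalTheory.ltP => le_w.
  do 3 wp_step; split=> //; first lia.
  split=> //; rewrite /= /upd /= next' w'; apply: is_best_take bestE _ _ => // _.
  exact: Order.POrderTheory.ltW.
wp_step; split=> //; first lia.
by split=> //; apply: is_best_skip => // _; split=> //; rewrite lt0n; apply/eqP.
Qed.

(** * Correctness and linear running time *)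

(** Two sweeps of [3 + 8 * offset n + 17 * n] steps each, one initial assignment, and the final test
    with its assignment. *)
Lemma wp_find_black :
  wp find_black (fun t s =>
    t <= 9 + 34 * n + 16 * offset n /\ correct_output e w Y (output s)) 0 (input w Y adj).
Proof.
do 3 wp_step; apply: (wp_sweep (A := Y) (J := classified)) => //.
- by move=> v s fr _ u; apply: frame_Y.
- exact: wp_classify.
- by split=> //=; rewrite big_pred0.
move=> t1 s1 le_t1 fr1 [cnt1 bad1 best1 flags1].
apply: wp_seq; apply: (wp_sweep (A := lonely e Y) (J := searched)) => //.
- by move=> v s fr [_ _ flags _].
- exact: wp_update_best.
(* At [k = n] the invariant of the first sweep covers all vertices and starts that of the second. *)
- split=> [||u|].
  + rewrite cnt1 -sum1_card big_mkcond [RHS]big_mkcond; apply: eq_bigr => u _.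
    by rewrite ltn_ord; case: (u \in _).
  + by rewrite bad1; split=> adm u; [apply: adm|move=> _; apply: adm].
  + by rewrite flags1 ltn_ord.
  + by rewrite best1.
move=> t2 s2 le_t2 [[_ zero2 _] _] [_ bad2 _ best2].
wp_step; rewrite zero2; case: eqP => bad; wp_step; (split; first lia); rewrite /output /=.
  have adm := bad2.1 bad.
  case: (ireg s2 r_best) best2 => [none|c [b [cb cand_b wE bestE]]].
    by move=> [b /(feasible_candidate graph_e)[_]]; apply/negP; apply: none.
  exists b; split=> //; split; first by apply/feasible_candidate.
  move=> b' /(feasible_candidate graph_e)[_ cand_b'].
  by rewrite -wE; apply: bestE.
by move=> [b /(feasible_candidate graph_e)[/bad2.2]].
Qed.

End Correctness.

Theorem theorem18 :
  exists (prog : cmd) (C : nat),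
    forall (R : realDomainType) (n : nat) (e : rel 'I_n)
           (w : {set 'I_n} -> R) (Y : {set 'I_n}) (adj : 'I_n -> seq 'I_n),
      simple_graph e -> connected_graph e -> adjacency_lists e adj ->
      exists (t : nat) (s : state R),
        [/\ exec prog (input w Y adj) t s,
            t <= C * (#|'I_n| + #|edges e|)
          & correct_output e w Y (output s)].
Proof.
(* [43 = 34 + 9]: as [n] is positive, the additive 9 is at most [9 * n]; the arcs cost at most
   [16 * 2 = 32] per edge. *)
exists find_black, 43 => R n e w Y adj graph_e [n_gt0 _] adjE.
have [t [s [E [le_t ok]]]] := wp_find_black w Y graph_e adjE.
exists t, s; split=> //.
have := offset_total graph_e adjE; move: n_gt0 le_t; rewrite card_ord; lia.
Qed.
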